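(* Let $n\ge 4$. With the tropical fan structures on $\mathcal{M}_{0,n,\mathrm{trop}}$ and $\mathcal{M}_{0,n-1,\mathrm{trop}}$ given by the embeddings $\varphi_n$ and $\varphi_{n-1}$ into $Q_n$ and $Q_{n-1}$ with lattices $\Lambda_n$ and $\Lambda_{n-1}$, the forgetful map $\operatorname{ft}:\mathcal{M}_{0,n,\mathrm{trop}}\to\mathcal{M}_{0,n-1,\mathrm{trop}}$ is a morphism of fans.
   Context: Tropical curves. A (rational, abstract) tropical curve is a finite connected metric graph $\Gamma$ of genus $0$ (a tree) all of whose vertices have valence at least $3$; its edges are either bounded, with a length $l(E)\in\mathbb{R}_{>0}$, or unbounded (called ends), isometric to $[0,\infty)$. $\mathcal{M}_{0,n,\mathrm{trop}}$ is the set of isomorphism classes of tuples $(\Gamma,x_1,\dots,x_n)$, where $\Gamma$ is a tropical curve with exactly $n$ ends and $x_1,\dots,x_n$ are its distinct ends; isomorphisms are homeomorphisms mapping the $i$-th end to the $i$-th end and each edge isometrically onto an edge. Forgetful map. $\operatorname{ft}$ sends $(\Gamma,x_1,\dots,x_n)$ to the stabilization of $(\Gamma,x_1,\dots,x_{n-1})$: remove the end $x_n$, and if its vertex thereby becomes $2$-valent, straighten it, i.e. delete this vertex and merge the two adjacent edges into one (of length the sum of the two lengths if both are bounded, and an unbounded end if one of them is unbounded). Embedding. Let $[n]=\{1,\dots,n\}$ and let $\mathbb{R}^{\binom n2}$ have coordinates indexed by the 2-element subsets of $[n]$. Let $\operatorname{dist}_n:\mathcal{M}_{0,n,\mathrm{trop}}\to\mathbb{R}^{\binom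 n2}$ send $(\Gamma,x_1,\dots,x_n)$ to $(\operatorname{dist}_\Gamma(x_i,x_j))_{\{i,j\}}$, where $\operatorname{dist}_\Gamma(x_i,x_j)$ is the sum of the lengths of the bounded edges on the unique path from $x_i$ to $x_j$. Let $\Phi_n:\mathbb{R}^n\to\mathbb{R}^{\binom n2}$, $a\mapsto(a_i+a_j)_{\{i,j\}}$, $Q_n:=\mathbb{R}^{\binom n2}/\operatorname{Im}(\Phi_n)$ with projection $q_n$, and $\varphi_n:=q_n\circ\operatorname{dist}_n$. It is known (Speyer–Sturmfels) that $\varphi_n$ is injective and its image is the support of a simplicial fan of pure dimension $n-3$, whose cones correspond to combinatorial types of curves. For $I\subset[n]$ with $1<|I|<n-1$ let $v_I=v_{[n]\setminus I}\in Q_n$ be the image under $\varphi_n$ of the tree with exactly one bounded edge, of length $1$, with the ends labeled by $I$ on one side and those labeled by $[n]\setminus I$ on the other. The $v_I$ generate the one-dimensional cones of this fan, and $\Lambda_n:=\langle v_I\rangle_{\mathbb{Z}}\subset Q_n$ is the lattice they generate. $\mathcal{M}_{0,n,\mathrm{trop}}$ is identified with this fan via $\varphi_n$. Morphisms. Given a fan $X$ in $V=\Lambda\otimes\mathbb{R}$ and a fan $Y$ in $V'=\Lambda'\otimes\mathbb{R}$ ($\Lambda,\Lambda'$ lattices), a morphism of fans $X\to Y$ is a map $|X|\to|Y|$ between the unions of their cones that is induced by a linear map $\Lambda\to\Lambda'$. Thus the statement means that $\varphi_{n-1}\circ\operatorname{ft}\circ\varphi_n^{-1}$ on $\varphi_n(\mathcal{M}_{0,n,\mathrm{trop}})$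 is the restriction of a linear map $Q_n\to Q_{n-1}$ sending $\Lambda_n$ into $\Lambda_{n-1}$. *)

(* Defs.v *)
From HB Require Import structures.
From mathcomp Require Import all_boot all_order all_algebra.
From mathcomp Require Import boolp reals.

Set Implicit Arguments.
Unset Strict Implicit.
Unset Printing Implicit Defensive.

Import Order.TTheory GRing.Theory Num.Theory.
Local Open Scope ring_scope.
Local Open Scope quotient_scope.

Section VectorQuotient.
Variables (K : fieldType) (V : vectType K) (U : {vspace V}).

Definition vquot := Quotient.quot U.
HB.instance Definition _ := GRing.Zmodule.on vquot.
HB.instance Definition _ := EqQuotient.on vquot.

Definition vquot_scale (a : K) (x : vquot) : vquot := \pi_vquot (a *: repr x).

Lemma pi_vquotP (u v : V) : reflect (\pi_vquot u = \pi_vquot v) (u - v \in U).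
Proof. by rewrite Quotient.idealrBE; apply: eqP. Qed.

Lemma pi_vquot_scale a (u : V) :
  \pi_vquot (a *: u) = vquot_scale a (\pi_vquot u).
Proof.
apply/pi_vquotP; rewrite -scalerBr memvZ //.
by apply/pi_vquotP; rewrite reprK.
Qed.

Lemma pi_vquotD (u v : V) : \pi_vquot (u + v) = \pi_vquot u + \pi_vquot v.
Proof. by rewrite !piE. Qed.

Let vquot_scaleA a b x : vquot_scale a (vquot_scale b x) = vquot_scale (a * b) x.
Proof. by rewrite {2}/vquot_scale -pi_vquot_scale scalerA. Qed.

Let vquot_scale1 : left_id 1 vquot_scale.
Proof. by move=> x; rewrite /vquot_scale scale1r reprK. Qed.

Let vquot_scaleDr : right_distributive vquot_scale +%R.
Proof.
move=> a x y; rewrite -[x]reprK -[y]reprK.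
by rewrite -pi_vquotD -!pi_vquot_scale scalerDr pi_vquotD.
Qed.

Let vquot_scaleDl x : {morph vquot_scale^~ x : a b / a + b}.
Proof.
by move=> a b; rewrite /vquot_scale scalerDl pi_vquotD.
Qed.

HB.instance Definition _ := GRing.Zmodule_isLmodule.Build K vquot
  vquot_scaleA vquot_scale1 vquot_scaleDr vquot_scaleDl.

Definition vquot_proj (u : V) : vquot := \pi_vquot u.

Let vquot_proj_linear : linear vquot_proj.
Proof. by move=> a u v; rewrite /vquot_proj pi_vquotD pi_vquot_scale. Qed.

HB.instance Definition _ := GRing.isLinear.Build K V vquot _ vquot_proj vquot_proj_linear.
End VectorQuotient.

Lemma acyclic_path_unique (T : eqType) (e : rel T) :
  symmetric e -> (forall c, (2 < size c)%N -> ~ ucycle e c) ->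
  forall (u : T) (p q : seq T),
  path e u p -> uniq (u :: p) -> path e u q -> uniq (u :: q) ->
  last u p = last u q -> p = q.
Proof.
move=> esym acyc u p; elim: p u => [|a p IH] u [|b q] //.
- move=> _ _ _ /andP[uq _] /= lq; case/negP: uq.
  by rewrite lq mem_last.
- move=> _ /andP[up _] _ _ /= lp; case/negP: up.
  by rewrite -lp mem_last.
have [<-|nab] := eqVneq a b.
  move=> /= /andP[_ pp] /andP[_ up] /andP[_ pq] /andP[_ uq] lpq.
  by congr cons; exact: (IH a).
move=> pp up pq uq /= lpq; exfalso.
have hasp : has (mem (b :: q)) (a :: p).
  by apply/hasP; exists (last a p); rewrite ?mem_last // /= lpq mem_last.
have [x [p1 [p2 [xq np1 ep]]]] : exists x p1 p2,
    [/\ x \in b :: q, ~~ has (mem (b :: q)) p1 & a :: p = p1 ++ x :: p2].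
  case/split_find: hasp => x p1 p2 xq np1.
  by exists x, p1, p2; rewrite cat_rcons.
have [q1 [q2 eq]] : exists q1 q2, b :: q = q1 ++ x :: q2.
  by case/splitPr: xq => q1 q2; exists q1, q2.
have pax : path e u (rcons p1 x).
  by move: pp; rewrite ep -cat_rcons cat_path => /andP[].
have pbx : path e u (rcons q1 x).
  by move: pq; rewrite eq -cat_rcons cat_path => /andP[].
have sz : (2 < size (u :: p1 ++ x :: rev q1))%N.
  rewrite /= size_cat /= size_rev addnS !ltnS lt0n addn_eq0.
  apply/negP=> /andP[/nilP p10 /nilP q10]; move: nab ep eq.
  by rewrite p10 q10 => /eqP nab [ax _] [bx _]; case: nab; rewrite ax bx.
apply: (acyc _ sz); apply/andP; split.
  rewrite /cycle rcons_cat -cat_rcons cat_path pax last_rcons /=.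
  have := rev_path e u (rcons q1 x).
  rewrite last_rcons belast_rcons rev_cons => ->.
  by rewrite (eq_path (e' := e)) // => y z; rewrite esym.
move: up uq; rewrite ep eq => up uq.
rewrite -cat_cons cat_uniq -[x :: rev q1]revK rev_cons revK.
have -> : uniq (u :: p1).
  by move: up; rewrite -cat_cons cat_uniq => /andP[].
have uq1x : uniq (rcons q1 x).
  by move: uq; rewrite /= -cat_rcons cat_uniq => /andP[_ /andP[]].
rewrite rev_uniq uq1x andbT /=; apply/hasPn => y.
rewrite mem_rev mem_rcons => yq /=.
rewrite inE negb_or; apply/andP; split.
  apply: contraTneq uq => <- /=.
  by rewrite -cat_rcons mem_cat mem_rcons yq.
apply/negP => yp; case/hasP: np1; exists y => //=.
by rewrite eq -cat_rcons mem_cat mem_rcons yq.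
Qed.

(* A tropical curve with n labelled ends.  A graph of genus 0 has neither loops
   nor multiple edges, so the bounded edges form a symmetric irreflexive
   relation on the vertices, which are numbered to keep the type of curves small.
   [mark i] is the vertex at which the i-th end is attached; [len u v] is
   meaningful only when [adj u v].  Labels are 0, ..., n-1. *)
Record tropical_curve (R : realType) (n : nat) := TropicalCurve {
  nverts : nat;
  adj : rel 'I_nverts;
  len : 'I_nverts -> 'I_nverts -> R;
  mark : 'I_n -> 'I_nverts;
  adj_sym : symmetric adj;
  adj_irr : irreflexive adj;
  len_sym : forall u v, adj u v -> len u v = len v u;
  len_gt0 : forall u v, adj u v -> 0 < len u v;
  adj_connected : forall u v, connect adj u v;
  adj_acyclic : forall c, (2 < size c)%N -> ~ ucycle adj c;
  valence_ge3 : forall v, (3 <= #|[pred w | adj v w]| + #|[pred i | mark i == v]|)%N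
}.
Arguments adj {R n}. Arguments len {R n}. Arguments mark {R n}.
Arguments nverts {R n}.

Section Curves.
Variable R : realType.

Definition valence n (C : tropical_curve R n) (v : 'I_(nverts C)) : nat :=
  #|[pred w | adj C v w]| + #|[pred i | mark C i == v]|.

(* As every vertex has valence at least 3, a homeomorphism which maps edges
   isometrically onto edges amounts to a bijection between the vertices. *)
Definition curve_iso n (C D : tropical_curve R n) : Prop :=
  exists f : 'I_(nverts C) -> 'I_(nverts D),
    [/\ bijective f,
        forall u v, adj D (f u) (f v) = adj C u v,
        forall u v, adj C u v -> len D (f u) (f v) = len C u v &
        forall i, mark D i = f (mark C i)].

Lemma curve_iso_refl n (C : tropical_curve R n) : curve_iso C C.
Proof. by exists id; split=> //; exists id. Qed.

Lemma curve_iso_sym n (C D : tropical_curve R n) :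
  curve_iso C D -> curve_iso D C.
Proof.
move=> [f [[g fK gK] fadj flen fmark]]; exists g; split.
- by exists f.
- by move=> u v; rewrite -fadj !gK.
- by move=> u v uv; rewrite -flen -?fadj !gK.
- by move=> i; rewrite fmark fK.
Qed.

Lemma curve_iso_trans n (C D E : tropical_curve R n) :
  curve_iso C D -> curve_iso D E -> curve_iso C E.
Proof.
move=> [f [bf fadj flen fmark]] [g [bg gadj glen gmark]].
exists (g \o f); split=> /= [|u v|u v uv|i]; first exact: bij_comp.
- by rewrite gadj fadj.
- by rewrite glen ?fadj // flen.
- by rewrite gmark fmark.
Qed.

HB.instance Definition _ n := gen_eqMixin (tropical_curve R n).
HB.instance Definition _ n := gen_choiceMixin (tropical_curve R n).

Definition curve_isob n : rel (tropical_curve R n) :=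
  fun C D => `[< curve_iso C D >].

Lemma curve_isob_equiv n : equiv_class_of (@curve_isob n).
Proof.
split=> [C|C D|D C E].
- exact/asboolP/curve_iso_refl.
- by apply/asboolP/asboolP; exact: curve_iso_sym.
- by move=> /asboolP CD /asboolP DE; apply/asboolP; exact: curve_iso_trans DE.
Qed.

Canonical curve_isob_equiv_rel n := EquivRelPack (@curve_isob_equiv n).

Definition moduli n := {eq_quot (@curve_isob n)}.
HB.instance Definition _ n := Choice.on (moduli n).
HB.instance Definition _ n := EqQuotient.on (moduli n).

Lemma pi_moduliP n (C D : tropical_curve R n) :
  \pi_(moduli n) C = \pi_(moduli n) D <-> curve_iso C D.
Proof.
split=> [/eqmodP|CD]; first by move/asboolP.
exact/eqmodP/asboolP.
Qed.

Lemma simple_path_ex n (C : tropical_curve R n) (u v : 'I_(nverts C)) :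
  exists p, [&& path (adj C) u p, uniq (u :: p) & last u p == v].
Proof.
have /connectP[p up ->] := adj_connected u v.
by case/shortenP: up => q uq Uq _; exists q; rewrite uq eqxx andbT.
Qed.

Definition simple_path n (C : tropical_curve R n) (u v : 'I_(nverts C)) :
  seq 'I_(nverts C) := xchoose (simple_path_ex u v).

Fixpoint path_len n (C : tropical_curve R n) (u : 'I_(nverts C))
    (p : seq 'I_(nverts C)) : R :=
  if p is w :: q then len C u w + path_len w q else 0.

Definition dist n (C : tropical_curve R n) (i j : 'I_n) : R :=
  path_len (mark C i) (simple_path (mark C i) (mark C j)).

Lemma simple_pathP n (C : tropical_curve R n) (u v : 'I_(nverts C)) :
  [/\ path (adj C) u (simple_path u v), uniq (u :: simple_path u v) &
      last u (simple_path u v) = v].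
Proof. by have /and3P[? ? /eqP ?] := xchooseP (simple_path_ex u v). Qed.

Lemma simple_path_unique n (C : tropical_curve R n) (u v : 'I_(nverts C)) p :
  path (adj C) u p -> uniq (u :: p) -> last u p = v -> p = simple_path u v.
Proof.
move=> pp up lp; have [qp uq lq] := simple_pathP u v.
apply: (acyclic_path_unique _ _ pp up qp uq); last by rewrite lp lq.
- exact: adj_sym.
- exact: adj_acyclic.
Qed.

Lemma dist_iso n (C D : tropical_curve R n) :
  curve_iso C D -> dist C =2 dist D.
Proof.
move=> [f [bf fadj flen fmark]] i j; rewrite /dist.
have [pp up lp] := simple_pathP (mark C i) (mark C j).
have -> : simple_path (mark D i) (mark D j) =
          map f (simple_path (mark C i) (mark C j)).
  apply/esym/simple_path_unique; rewrite !fmark.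
  - by rewrite path_map (eq_path (e' := adj C)).
  - by rewrite -map_cons map_inj_uniq //; exact: bij_inj.
  - by rewrite last_map lp.
rewrite fmark.
have aux u p : path (adj C) u p -> path_len u p = path_len (f u) (map f p).
  by elim: p u => //= w p IH u /andP[uw wp]; rewrite flen // IH.
exact: aux.
Qed.

Definition old_end n (i : 'I_n) : 'I_n.+1 := widen_ord (leqnSn n) i.

Lemma card_old_end n (P : pred 'I_n.+1) :
  #|[pred i | P i]| = (#|[pred i | P (old_end i)]| + P ord_max)%N.
Proof.
rewrite -!sum1_card !big_mkcond big_ord_recr /=.
by congr (_ + _)%N; rewrite [RHS]big_mkcond.
Qed.

Lemma card_lift m (v : 'I_m) (P : pred 'I_m) :
  #|[pred w | P w]| = (#|[pred w | P (lift v w)]| + P v)%N.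
Proof.
rewrite -!sum1_card !big_mkcond (bigD1_ord v) //= addnC.
by congr (_ + _)%N; rewrite [RHS]big_mkcond.
Qed.

Section DropEnd.
Variables (n : nat) (C : tropical_curve R n.+1).
Let v := mark C ord_max.
Hypothesis hv : valence v <> 3.

Lemma drop_end_stable w :
  (3 <= #|[pred u | adj C w u]| +
        #|[pred i : 'I_n | mark C (old_end i) == w]|)%N.
Proof.
have := valence_ge3 w; rewrite (card_old_end (fun i => mark C i == w)) addnA.
have [vw|] := eqVneq (mark C ord_max) w; last by rewrite addn0.
move/eqP: hv; rewrite /valence (card_old_end (fun i => mark C i == v)).
rewrite -[mark C ord_max]/v /v vw eqxx addnA addn1 eqSS ltnS.
by rewrite eq_sym => ne2 le2; rewrite ltn_neqAle ne2.
Qed.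

Definition drop_end : tropical_curve R n :=
  @TropicalCurve R n (nverts C) (adj C) (len C) (fun i => mark C (old_end i))
    (@adj_sym _ _ C) (@adj_irr _ _ C) (@len_sym _ _ C) (@len_gt0 _ _ C)
    (@adj_connected _ _ C) (@adj_acyclic _ _ C) drop_end_stable.
End DropEnd.

Section Straighten.
Variables (n : nat) (hn : (3 <= n)%N) (C : tropical_curve R n.+1).
Let v := mark C ord_max.
Hypothesis hv : valence v = 3.

Lemma valence_old_end :
  (#|[pred w | adj C v w]| + #|[pred i | mark C (old_end i) == v]| = 2)%N.
Proof.
move: hv; rewrite /valence (card_old_end (fun i => mark C i == v)).
by rewrite eqxx addnA addn1 => -[].
Qed.

Lemma neighbour_ex : exists w, adj C v (lift v w).
Proof.
apply/existsP; apply: contraLR hn => /existsPn none.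
have nv w : adj C v w = false.
  by have [w' ->|->] := unliftP v w; [exact/negbTE | exact: adj_irr].
have onlyv w : w = v.
  have /connectP[[|a p] //= /andP[]] := adj_connected v w.
  by rewrite nv.
rewrite -leqNgt -valence_old_end [#|[pred w | _]|]eq_card0 ?add0n; last first.
  by move=> w; rewrite !inE nv.
rewrite [X in (_ <= X)%N](@eq_card _ _ predT) ?card_ord //.
by move=> i; rewrite !inE; apply/eqP.
Qed.

(* v becomes 2-valent once the last end is removed; [lift v] enumerates the
   vertices other than v. *)
Definition straight_adj : rel 'I_(nverts C).-1 := fun a b =>
  adj C (lift v a) (lift v b) ||
  [&& adj C (lift v a) v, adj C v (lift v b) & a != b].

Definition straight_len (a b : 'I_(nverts C).-1) : R :=
  if adj C (lift v a) (lift v b) then len C (lift v a) (lift v b)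
  else len C (lift v a) v + len C v (lift v b).

(* If another end is attached to v, then v has exactly one neighbour, and this
   end absorbs the bounded edge joining them. *)
Definition straight_mark (i : 'I_n) : 'I_(nverts C).-1 :=
  if unlift v (mark C (old_end i)) is Some w then w else xchoose neighbour_ex.

Lemma straight_adj_sym : symmetric straight_adj.
Proof.
move=> a b; rewrite /straight_adj ![adj C _ v]adj_sym adj_sym eq_sym.
by congr (_ || _); rewrite andbCA.
Qed.

Lemma straight_adj_irr : irreflexive straight_adj.
Proof. by move=> a; rewrite /straight_adj adj_irr eqxx !andbF. Qed.

Lemma straight_len_sym a b :
  straight_adj a b -> straight_len a b = straight_len b a.
Proof.
rewrite /straight_adj /straight_len [adj C (lift v b) _]adj_sym.
case: ifP => [ab _|_ /= /and3P[av vb _]]; first exact: len_sym.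
by rewrite addrC (len_sym av) (len_sym vb).
Qed.

Lemma straight_len_gt0 a b : straight_adj a b -> 0 < straight_len a b.
Proof.
rewrite /straight_adj /straight_len.
case: ifP => [ab _|_ /= /and3P[av vb _]]; first exact: len_gt0.
by rewrite addr_gt0 ?len_gt0.
Qed.

Lemma straight_adj_connected a b : connect straight_adj a b.
Proof.
have /connectP[p] := adj_connected (lift v a) (lift v b).
have [k] := ubnP (size p); elim: k p a => // k IH [|c p] a.
  by move=> _ _ /= /lift_inj ->.
move=> /= sp /andP[ac cp] lp.
have [c' ec|ec] := unliftP v c; subst c.
  apply: (@connect_trans _ _ c'); last exact: (IH p).
  by apply: connect1; rewrite /straight_adj ac.
case: p sp cp lp => [|d p] /= sp cp lp.
  by have := neq_lift v b; rewrite lp eqxx.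
case/andP: cp => vd dp; have [d' ed|ed] := unliftP v d; subst d; last first.
  by rewrite adj_irr in vd.
apply: (@connect_trans _ _ d'); last by apply: (IH p) => //; exact: ltnW.
have [->//|ad] := eqVneq a d'.
by apply: connect1; rewrite /straight_adj ac vd ad orbT.
Qed.

Lemma neighbours_le2 a b w : a != b ->
  adj C v (lift v a) -> adj C v (lift v b) -> adj C v (lift v w) ->
  (w == a) || (w == b).
Proof.
move=> ab va vb vw; apply: contraTT (leqnn 2) => /norP[wa wb].
rewrite -ltnNge -{2}valence_old_end; apply: leq_trans (leq_addr _ _).
rewrite (card_lift v) adj_irr addn0.
rewrite (cardD1 a) (cardD1 b) (cardD1 w) !inE va vb vw.
by rewrite (eq_sym b) ab wa wb.
Qed.

Lemma straight_adj_acyclic c : (2 < size c)%N -> ~ ucycle straight_adj c.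
Proof.
move=> szc /andP[cyc uc]; set e1 := fun a b => adj C (lift v a) (lift v b).
have [cyc1|ncyc1] := boolP (cycle e1 c).
  apply: (@adj_acyclic _ _ C (map (lift v) c)); first by rewrite size_map.
  by rewrite /ucycle map_inj_uniq ?uc ?andbT ?cycle_map //; exact: lift_inj.
have [a ac nadj] : exists2 a, a \in c & ~~ e1 a (next c a).
  apply/hasP; apply: contraR ncyc1 => /hasPn ok.
  by apply: cycle_from_next => // x /ok; rewrite negbK.
have bc : next c a \in c by rewrite mem_next.
have [k s es] := rot_to bc; have ls : last (next c a) s = a.
  have ubs : uniq (next c a :: s) by rewrite -es rot_uniq.
  have := prev_next uc a; rewrite -(prev_rot k uc) es prev_nth mem_head.
  by rewrite memNindex ?nth_last // -?last_nth //; case/andP: ubs.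
move: (next c a) nadj es ls {bc} => b nadj es ls.
have szs : (1 < size s)%N by move: szc; rewrite -(size_rot k) es.
have us : uniq (b :: s) by rewrite -es rot_uniq.
have : cycle straight_adj (b :: s) by rewrite -es rot_cycle.
rewrite /= rcons_path ls => /andP[ps].
rewrite /straight_adj [X in X || _](negbTE nadj) /= => /and3P[av vb ab].
have va : adj C v (lift v a) by rewrite adj_sym.
have ps1 : path e1 b s.
  apply/(pathP b) => i lti; have /(pathP b)/(_ i lti) := ps.
  rewrite /straight_adj => /orP[//|/and3P[xv vy xy]].
  rewrite adj_sym in xv.
  have ib : nth b s i != b.
    by rewrite -[nth b s i]/(nth b (b :: s) i.+1) -[X in _ != X]/(nth b (b :: s) 0) nth_uniq.
  have := neighbours_le2 ab va vb vy; rewrite (negbTE ib) orbF => /eqP ya.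
  have := neighbours_le2 ab va vb xv; rewrite -ya (negbTE xy) /= => xb.
  have i0 : i = 0%N.
    apply/eqP; rewrite -(nth_uniq b (s := b :: s)) //=.
    exact: ltnW.
  have : nth b (b :: s) i.+1 == nth b (b :: s) (size s).
    by rewrite -last_nth ls /= ya.
  by rewrite nth_uniq //= i0 => /eqP sz1; rewrite -sz1 in szs.
apply: (@adj_acyclic _ _ C (v :: map (lift v) (b :: s))).
  by rewrite /= size_map ltnS ltnW.
apply/andP; split.
  by rewrite /= rcons_path last_map ls vb av path_map ps1.
rewrite cons_uniq map_inj_uniq ?us ?andbT; last exact: lift_inj.
by apply/mapP=> -[x _ /eqP]; rewrite (negbTE (neq_lift v x)).
Qed.

Lemma straight_stable w :
  (3 <= #|[pred u | straight_adj w u]| + #|[pred i | straight_mark i == w]|)%N.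
Proof.
have := valence_ge3 (lift v w).
rewrite (card_old_end (fun i => mark C i == lift v w)).
rewrite -/v (negbTE (neq_lift v w)) addn0 (card_lift v) => le3.
have subN : [pred u | adj C (lift v w) (lift v u)] \subset
            [pred u | straight_adj w u].
  by apply/subsetP=> u; rewrite !inE /straight_adj => ->.
have subE : [pred i | mark C (old_end i) == lift v w] \subset
            [pred i | straight_mark i == w].
  by apply/subsetP=> i; rewrite !inE /straight_mark => /eqP->; rewrite liftK.
have [wv|nwv] := boolP (adj C (lift v w) v); last first.
  apply: leq_trans le3 _; rewrite (negbTE nwv) addn0.
  by apply: leq_add; apply: subset_leq_card.
apply: leq_trans le3 _; rewrite wv addn1.
have vw : adj C v (lift v w) by rewrite adj_sym.
have [/existsP[y /andP[yw vy]]|/existsPn none] :=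
  boolP [exists y, (y != w) && adj C v (lift v y)].
  apply: leq_add; last exact: subset_leq_card.
  apply: proper_card; apply/properP; split=> //; exists y.
    by rewrite inE /straight_adj wv vy eq_sym yw orbT.
  rewrite inE; apply/negP => wy.
  apply: (@adj_acyclic _ _ C [:: v; lift v w; lift v y]) => //.
  rewrite /ucycle /= vw wy adj_sym vy /= !inE (inj_eq lift_inj) eq_sym.
  by rewrite (negbTE (neq_lift v y)) !orbF eq_sym neq_lift eq_sym yw.
have only y : adj C v (lift v y) -> y = w.
  by move=> vy; apply/eqP; have := none y; rewrite vy andbT negbK.
rewrite addSnnS; apply: leq_add; first exact: subset_leq_card.
have [i0 mi0] : exists i, mark C (old_end i) == v.
  apply/existsP; have := valence_old_end; apply: contra_eqT => /existsPn noend.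
  rewrite [X in (_ + X)%N]eq_card0 ?addn0; last first.
    by move=> i; rewrite !inE (negbTE (noend i)).
  rewrite (card_lift v) adj_irr addn0 (@eq_card1 _ w) // => y.
  by rewrite !inE; apply/idP/eqP=> [/only|->].
apply: proper_card; apply/properP; split=> //; exists i0.
  rewrite inE /straight_mark (eqP mi0) unlift_none.
  by apply/eqP/only/(xchooseP neighbour_ex).
by rewrite inE (eqP mi0) neq_lift.
Qed.

Definition straighten : tropical_curve R n :=
  @TropicalCurve R n (nverts C).-1 straight_adj straight_len straight_mark
    straight_adj_sym straight_adj_irr straight_len_sym straight_len_gt0
    straight_adj_connected straight_adj_acyclic straight_stable.

End Straighten.

(* The valence of the vertex of the last end is taken before that end is removed,
   whence 3.  The bound on n excludes a curve with two ends only. *)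
Definition ft_curve n (hn : (3 <= n)%N) (C : tropical_curve R n.+1) :
    tropical_curve R n :=
  match eq_comparable (valence (mark C ord_max)) 3 with
  | left h => straighten hn h
  | right h => drop_end h
  end.

Lemma ft_curve_iso n (hn : (3 <= n)%N) (C D : tropical_curve R n.+1) :
  curve_iso C D -> curve_iso (ft_curve hn C) (ft_curve hn D).
Proof.
move=> [f [bf fadj flen fmark]]; have fi := bij_inj bf.
have eqo : nverts C = nverts D by have := bij_eq_card bf; rewrite !card_ord.
have fval u : valence (f u) = valence u.
  rewrite /valence -(card_image fi [pred w | adj C u w]); congr (_ + _)%N.
    apply: eq_card => w; rewrite !inE; have [g fK gK] := bf.
    by rewrite -{1}[w]gK fadj -[w in RHS]gK mem_image.
  by apply: eq_card => i; rewrite !inE fmark (inj_eq fi).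
rewrite /ft_curve; case: eq_comparable => hC; case: eq_comparable => hD; last first.
- by exists f; split=> //= i; rewrite fmark.
- by case: (hC); rewrite -fval -fmark hD.
- by case: (hD); rewrite fmark fval hC.
have /fin_all_exists[g gP] (x : 'I_(nverts C).-1) : exists y : 'I_(nverts D).-1,
    lift (mark D ord_max) y = f (lift (mark C ord_max) x).
  have [y ->|/eqP] := unliftP (mark D ord_max) (f (lift (mark C ord_max) x)).
    by exists y.
  by rewrite fmark (inj_eq fi) eq_sym (negbTE (neq_lift _ _)).
have gi : injective g.
  by move=> x y /(congr1 (lift (mark D ord_max))); rewrite !gP => /fi/lift_inj.
have gadj x y : straight_adj (g x) (g y) = straight_adj x y.
  by rewrite /straight_adj !gP fmark !fadj (inj_eq gi).
exists g; split=> //=.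
- by apply: inj_card_bij => //; rewrite !card_ord eqo.
- move=> x y; rewrite /straight_adj /straight_len !gP fmark fadj.
  case: ifP => [xy _|_ /= /and3P[xv vy _]]; first by rewrite flen.
  by rewrite !flen.
move=> i; rewrite /straight_mark.
have [w ew|ew] := unliftP (mark C ord_max) (mark C (old_end i)).
  have -> : mark D (old_end i) = lift (mark D ord_max) (g w).
    by rewrite gP -ew fmark.
  by rewrite liftK.
have eD : mark D (old_end i) = mark D ord_max by rewrite !fmark ew.
rewrite eD unlift_none.
set x := xchoose (neighbour_ex hn hC); set y := xchoose (neighbour_ex hn hD).
have vx : adj C (mark C ord_max) (lift (mark C ord_max) x).
  exact: (xchooseP (neighbour_ex hn hC)).
have vy : adj D (mark D ord_max) (lift (mark D ord_max) y).
  exact: (xchooseP (neighbour_ex hn hD)).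
have vgx : adj D (mark D ord_max) (lift (mark D ord_max) (g x)).
  by rewrite gP fmark fadj.
apply/eqP; apply: contraTT (leqnn 2) => neq.
rewrite -ltnNge -{2}(valence_old_end hD) (card_lift (mark D ord_max)) adj_irr.
rewrite (cardD1 y) (cardD1 (g x)) !inE vy vgx eq_sym neq (cardD1 i) !inE.
by rewrite eD eqxx /= addn0 !add1n addnS !addSn !ltnS.
Qed.

Definition ft n (hn : (3 <= n)%N) (x : moduli n.+1) : moduli n :=
  \pi_(moduli n) (ft_curve hn (repr x)).

Lemma ft_pi n (hn : (3 <= n)%N) (C : tropical_curve R n.+1) :
  ft hn (\pi_(moduli n.+1) C) = \pi_(moduli n) (ft_curve hn C).
Proof.
by apply/pi_moduliP/ft_curve_iso/pi_moduliP; rewrite reprK.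
Qed.
End Curves.

Section Embedding.
Variables (R : realType) (n : nat).
Implicit Types C : tropical_curve R n.

(* The 2-element subsets {i, j}, written with i < j. *)
Definition pairs := {p : 'I_n * 'I_n | (p.1 < p.2)%N}.
HB.instance Definition _ := Finite.on pairs.

Definition dist_vec C : {ffun pairs -> R^o} :=
  [ffun p => dist C (val p).1 (val p).2].

Definition Phi (a : {ffun 'I_n -> R^o}) : {ffun pairs -> R^o} :=
  [ffun p => a (val p).1 + a (val p).2].

Lemma Phi_is_linear : linear Phi.
Proof.
by move=> k a b; apply/ffunP=> p; rewrite !ffunE scalerDr addrACA.
Qed.
HB.instance Definition _ := GRing.isLinear.Build R {ffun 'I_n -> R^o}
  {ffun pairs -> R^o} _ Phi Phi_is_linear.

Definition Qn : lmodType R := vquot (limg (linfun Phi)).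

Definition phi (x : moduli R n) : Qn := vquot_proj _ (dist_vec (repr x)).

Lemma phi_pi C : phi (\pi_(moduli R n) C) = vquot_proj _ (dist_vec C).
Proof.
congr vquot_proj; apply/ffunP=> p; rewrite !ffunE; apply: dist_iso.
by apply/pi_moduliP; rewrite reprK.
Qed.

Definition splitting := {I : {set 'I_n} | (1 < #|I| < n.-1)%N}.
HB.instance Definition _ := Finite.on splitting.

(* The curve with one bounded edge, of length 1, separating I from its complement. *)
Section SplitCurve.
Variable I : splitting.
Definition split_adj : rel 'I_2 := fun u v => u != v.
Definition split_len : 'I_2 -> 'I_2 -> R := fun _ _ => 1.
Definition split_mark (i : 'I_n) : 'I_2 :=
  if i \in val I then ord0 else ord_max.

Lemma split_adj_sym : symmetric split_adj.
Proof. by move=> u v; rewrite /split_adj eq_sym. Qed.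

Lemma split_adj_irr : irreflexive split_adj.
Proof. by move=> u; rewrite /split_adj eqxx. Qed.

Lemma split_adj_connected u v : connect split_adj u v.
Proof. by have [->|uv] := eqVneq u v; [exact: connect0|exact: connect1]. Qed.

Lemma split_adj_acyclic c : (2 < size c)%N -> ~ ucycle split_adj c.
Proof.
move=> sz /andP[_ /card_uniqP cc].
by have := max_card (mem c); rewrite cc card_ord leqNgt sz.
Qed.

Lemma split_stable v :
  (3 <= #|[pred w | split_adj v w]| + #|[pred i | split_mark i == v]|)%N.
Proof.
have [cI1 cI2] := andP (valP I).
have -> : #|[pred w | split_adj v w]| = 1%N.
  have := cardC1 v; rewrite card_ord /= => e; rewrite -[RHS]e; apply: eq_card => w.
  by rewrite !inE /split_adj eq_sym.
rewrite add1n ltnS.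
have [v0|v1] := eqVneq v ord0.
  rewrite (leq_trans cI1) //; apply/subset_leq_card/subsetP=> i.
  by rewrite !inE /split_mark v0 => ->.
have -> : v = ord_max by apply/val_inj; case: v v1 => -[|[|]].
apply: (@leq_trans #|~: val I|).
  by rewrite -(leq_add2l #|val I|) cardsC card_ord addn2 -ltn_predRL.
apply/subset_leq_card/subsetP=> i.
by rewrite !inE /split_mark => /negbTE->.
Qed.

Definition split_curve : tropical_curve R n :=
  TropicalCurve split_adj_sym split_adj_irr (len := split_len) (fun _ _ _ => erefl)
    (fun _ _ _ => ltr01) split_adj_connected split_adj_acyclic split_stable.
End SplitCurve.

Definition vI (I : splitting) : Qn := phi (\pi_(moduli R n) (split_curve I)).

Definition Lambda (x : Qn) : Prop :=
  exists c : splitting -> int, x = \sum_I vI I *~ c I.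
End Embedding.

(* A and B stand for the supports of two fans, identified with subsets of V and W
   through the embeddings i and j; L and L' are the lattices.  The last equation
   says that j \o f \o i^-1 is the restriction of h to the image of i. *)
Definition fan_morphism (R : realType) (A B : Type) (V W : lmodType R)
    (i : A -> V) (L : V -> Prop) (j : B -> W) (L' : W -> Prop)
    (f : A -> B) : Prop :=
  exists h : {linear V -> W},
    (forall x, L x -> L' (h x)) /\ (forall a, j (f a) = h (i a)).

(* Main.v *)
Require Import Defs.
From HB Require Import structures.
From mathcomp Require Import all_boot all_order all_algebra.
From mathcomp Require Import boolp reals zify.

(** The linear map is the restriction of a distance vector to the pairs of old
ends.  It sends [Phi a] to [Phi] of the restriction of [a], so it descends to a
linear map [forget] between the quotients, and two facts remain.

The map induces [ft] ([phi_ft]).  If the vertex [v] of the last end keeps valence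
at least 3, then removing the end changes no distance between old ends.  If [v] is
straightened, the only length that can be lost is that of a bounded edge at [v]
absorbed by an old end attached to [v].  Each distance from an old end [i] to
another old end loses the length [absorbed i] swallowed by [i], plus that swallowed
by the other end; hence the distance vectors differ by [Phi absorbed]
([dist_straighten]), which vanishes in the quotient.  The distances are compared
by erasing [v] from a simple path of the original curve: the result is a simple
path of the straightened curve, of the same length ([straighten_path]).

The map preserves the lattices ([forget_vI]).  The distance vector of the curve of
a split [I] is the indicator of the pairs separated by [I].  Its restriction is the
indicator of the pairs separated by the trace [A] of [I] on the old ends.  If [A]
is itself a splitting, this gives the generator attached to [A].  Otherwise [A] or
its complement is a singleton [k], and the indicator is [Phi] of the [k]-th basis
vector, so the generator is sent to 0. *)

Set Implicit Arguments.
Unset Strict Implicit.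
Unset Printing Implicit Defensive.

Import Order.TTheory GRing.Theory Num.Theory.
Local Open Scope ring_scope.
Local Open Scope quotient_scope.

(** * Linear maps induced on quotients *)

Section QuotientMap.
Variables (K : fieldType) (V W : vectType K).
Variables (U : {vspace V}) (U' : {vspace W}) (f : {linear V -> W}).

Definition vquot_map (x : vquot U) : vquot U' := vquot_proj U' (f (repr x)).

Hypothesis fU : forall u, u \in U -> f u \in U'.

Lemma vquot_map_proj u : vquot_map (vquot_proj U u) = vquot_proj U' (f u).
Proof.
by apply/pi_vquotP; rewrite -raddfB fU //; apply/pi_vquotP; rewrite reprK.
Qed.

Lemma vquot_map_linear : linear vquot_map.
Proof.
move=> a x y; rewrite -[x]reprK -[y]reprK -!/(vquot_proj U _).
by rewrite -linearP !vquot_map_proj !linearP.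
Qed.
End QuotientMap.

(** * Distances in a tropical curve *)

Section Paths.
Variables (R : realType) (n : nat) (C : tropical_curve R n).

Lemma path_len_rcons u p w :
  path_len (C := C) u (rcons p w) = path_len u p + len C (last u p) w.
Proof. by elim: p u => [|a p IH] u /=; rewrite ?addr0 ?add0r // IH addrA. Qed.

(** In a tree the simple path chosen by [dist] is the only one, so any simple path
computes the distance. *)
Lemma dist_path i j p : path (adj C) (mark C i) p -> uniq (mark C i :: p) ->
  last (mark C i) p = mark C j -> dist C i j = path_len (mark C i) p.
Proof. by move=> pp up lp; rewrite (simple_path_unique pp up lp). Qed.

Lemma path_len_rev u p : path (adj C) u p ->
  path_len (last u p) (rev (belast u p)) = path_len u p.
Proof.
elim: p u => [|a p IH] u //= /andP[ua ap].
rewrite rev_cons path_len_rcons IH // addrC; congr (_ + _).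
rewrite (len_sym ua); congr (len C _ u).
by case: p {IH ap} => //= b p; rewrite rev_cons last_rcons.
Qed.

Lemma dist_sym i j : dist C i j = dist C j i.
Proof.
have [pp up lp] := simple_pathP (mark C i) (mark C j).
rewrite {1}/dist; move: (simple_path _ _) pp up lp => p pp up lp.
rewrite -(path_len_rev pp) lp; apply/esym/dist_path.
- by rewrite -lp rev_path (eq_path (e' := adj C)) // => x y; rewrite adj_sym.
- by rewrite -lp -rev_rcons -lastI rev_uniq.
- by case: p {pp up} lp => [|a p] //= _; rewrite rev_cons last_rcons.
Qed.
End Paths.

(** * Distances after the last end is forgotten *)

Lemma dist_drop_end (R : realType) n (C : tropical_curve R n.+1)
    (hv : valence (mark C ord_max) <> 3) i j :
  dist (drop_end hv) i j = dist C (old_end i) (old_end j).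
Proof.
have [pp up lp] := simple_pathP (mark C (old_end i)) (mark C (old_end j)).
rewrite (@dist_path _ _ (drop_end hv) _ _ _ pp up lp) /dist.
have path_lenE u p : path_len (C := drop_end hv) u p = path_len (C := C) u p.
  by elim: p u => //= w p IH u; rewrite IH.
exact: path_lenE.
Qed.

Section StraightenDist.
Variables (R : realType) (n : nat) (hn : (3 <= n)%N) (C : tropical_curve R n.+1).
Let v := mark C ord_max.
Hypothesis hv : valence v = 3.
Let S := straighten hn hv.

Let w0 := xchoose (neighbour_ex hn hv).

(** Simple paths are easier to push forward to the straightened curve than to pull
back: erasing [v] keeps a sequence duplicate-free, whereas reinserting [v] would
require knowing that it is crossed at most once. *)
Lemma straighten_path (a : 'I_(nverts C).-1) p b :
  path (adj C) (lift v a) p -> uniq (lift v a :: p) ->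
  last (lift v a) p = lift v b ->
  let q := pmap (unlift v) p in
  [/\ path (adj S) a q, uniq (a :: q), last a q = b &
      path_len (C := S) a q = path_len (lift v a) p].
Proof.
move=> ap up lp q.
have -> : uniq (a :: q).
  have -> : a :: q = pmap (unlift v) (lift v a :: p) by rewrite /= liftK.
  apply: (@pmap_uniq _ _ _ (lift v)) up => x.
  by case: unliftP.
suff [] : [/\ path (adj S) a q, last a q = b &
    path_len (C := S) a q = path_len (lift v a) p] by [].
rewrite {}/q; have [k] := ubnP (size p); elim: k p a ap up lp => // k IH [|c p] a.
  by move=> _ _ /= /lift_inj.
move=> /= /andP[ac cp] /andP[ncp ucp] lp sp.
have [c' ec|ec] := unliftP v c; subst c => /=.
  have [pq lq <-] := IH p c' cp ucp lp sp.
  by rewrite /straight_len /straight_adj ac.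
case: p sp cp lp ncp ucp => [|d p] /= sp cp lp ncp ucp.
  by have := neq_lift v b; rewrite -lp eqxx.
case/andP: cp => vd dp; have [d' ed|ed] := unliftP v d; subst d; last first.
  by rewrite adj_irr in vd.
have [pq lq <-] := IH p d' dp (andP ucp).2 lp (ltnW sp).
have nad : a != d' by apply: contraNneq ncp => ->; rewrite !inE eqxx orbT.
(* [straight_len] adds the two edges at [v] only if [a] and [d'] are not already
   adjacent, which would close a triangle through [v]. *)
have tri : adj C (lift v a) (lift v d') = false.
  apply/negP=> ad; apply: (@adj_acyclic _ _ C [:: lift v a; v; lift v d']) => //.
  rewrite /ucycle /= ac vd adj_sym ad /= !inE (inj_eq lift_inj) negb_or nad.
  by rewrite eq_sym !neq_lift.
by split=> //=; rewrite /straight_adj /straight_len tri ?ac ?vd ?nad ?addrA.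
Qed.

Lemma neighbour_adj : adj C v (lift v w0).
Proof. exact: (xchooseP (neighbour_ex hn hv)). Qed.

(** Once the last end is removed, [v] has valence 2, so an old end and the
neighbour [w0] account for everything attached to it. *)
Lemma end_neighbour i w : mark C (old_end i) = v -> adj C v w -> w = lift v w0.
Proof.
move=> iv vw; apply/eqP; apply: contraTT (leqnn 2) => neq.
rewrite -ltnNge -{2}(valence_old_end hv) (cardD1 w) (cardD1 (lift v w0)) !inE.
rewrite vw neighbour_adj eq_sym neq (cardD1 i) !inE iv eqxx.
by rewrite !add1n addnS !addSn !ltnS.
Qed.

Lemma end_unique i j :
  mark C (old_end i) = v -> mark C (old_end j) = v -> i = j.
Proof.
move=> iv jv; apply/eqP; apply: contraTT (leqnn 2) => neq.
rewrite -ltnNge -{2}(valence_old_end hv) (cardD1 (lift v w0)) (cardD1 i).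
rewrite (cardD1 j) !inE neighbour_adj iv jv eqxx eq_sym neq.
by rewrite !add1n !addSn !addnS !ltnS.
Qed.

(** The length lost by the [i]-th end: with at most one old end at [v], this
function is supported at a single end, or vanishes. *)
Definition absorbed (i : 'I_n) : R^o :=
  if mark C (old_end i) == v then len C v (lift v w0) else 0.

Lemma straight_mark_lift i b : mark C (old_end i) = lift v b -> mark S i = b.
Proof. by rewrite /= /straight_mark => ->; rewrite liftK. Qed.

Lemma straight_mark_v i : mark C (old_end i) = v -> mark S i = w0.
Proof. by rewrite /= /straight_mark => ->; rewrite unlift_none. Qed.

(** If an old end sits at [v], every simple path from it first crosses the unique
bounded edge at [v], which is what the straightened end absorbs. *)
Lemma dist_straighten i j : i != j ->
  dist C (old_end i) (old_end j) = dist S i j + (absorbed i + absorbed j).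
Proof.
(* At most one old end is attached to [v], so by symmetry it can be taken to
   be [i]. *)
wlog [b jb] : i j / exists b, mark C (old_end j) = lift v b.
  move=> th ij; have [b jb|jv] := unliftP v (mark C (old_end j)).
    by apply: th => //; exists b.
  have [a ia|iv] := unliftP v (mark C (old_end i)).
    rewrite dist_sym (dist_sym S) (addrC (absorbed i)) th ?(eq_sym j) //.
    by exists a.
  by rewrite (end_unique iv jv) eqxx in ij.
move=> _; rewrite /absorbed jb (negbTE _ : lift v b == v = false) ?addr0; last first.
  by rewrite eq_sym neq_lift.
have [pp up lp] := simple_pathP (mark C (old_end i)) (mark C (old_end j)).
rewrite [LHS]/dist; move: (simple_path _ _) pp up lp => p.
have mj := straight_mark_lift jb; rewrite jb.
have [a ia|iv] := unliftP v (mark C (old_end i)).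
  have mi := straight_mark_lift ia; rewrite ia eq_sym (negbTE (neq_lift _ _)) addr0.
  move=> pp up lp; have [qp uq lq <-] := straighten_path pp up lp.
  by rewrite (@dist_path _ _ S i j (pmap (unlift v) p)) ?mi ?mj.
have mi := straight_mark_v iv; rewrite iv eqxx.
case: p => [|c p] /=.
  by move=> _ _ /eqP; rewrite (negbTE (neq_lift _ _)).
move=> /andP[vc pp] /andP[_ up] lp.
have ec := end_neighbour iv vc; rewrite ec in pp up lp *.
have [qp uq lq <-] := straighten_path pp up lp.
by rewrite addrC (@dist_path _ _ S i j (pmap (unlift v) p)) ?mi ?mj.
Qed.
End StraightenDist.

(** * The linear map inducing the forgetful map *)

Section Restriction.
Variables (R : realType) (n : nat).

Definition old_pair (p : pairs n) : pairs n.+1 :=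
  Sub (old_end (val p).1, old_end (val p).2) (valP p).

Definition restrict (x : {ffun pairs n.+1 -> R^o}) : {ffun pairs n -> R^o} :=
  [ffun p => x (old_pair p)].

Lemma restrict_linear : linear restrict.
Proof. by move=> a x y; apply/ffunP=> p; rewrite !ffunE. Qed.
HB.instance Definition _ := GRing.isLinear.Build R {ffun pairs n.+1 -> R^o}
  {ffun pairs n -> R^o} _ restrict restrict_linear.

Lemma mem_Phi m (a : {ffun 'I_m -> R^o}) :
  Phi a \in limg (linfun (@Phi R m)).
Proof. by rewrite -(lfunE (@Phi R m)) memv_img ?memvf. Qed.

Lemma restrict_Phi u : u \in limg (linfun (@Phi R n.+1)) ->
  restrict u \in limg (linfun (@Phi R n)).
Proof.
case/memv_imgP=> a _ ->; rewrite lfunE /=.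
suff -> : restrict (Phi a) = Phi [ffun i => a (old_end i)] by exact: mem_Phi.
by apply/ffunP=> p; rewrite !ffunE.
Qed.

Definition forget : Qn R n.+1 -> Qn R n := vquot_map _ restrict.

Lemma forget_linear : linear forget.
Proof. exact/vquot_map_linear/restrict_Phi. Qed.
HB.instance Definition _ := GRing.isLinear.Build R (Qn R n.+1) (Qn R n) _
  forget forget_linear.

Lemma forget_phi C :
  forget (phi (\pi_(moduli R n.+1) C)) = vquot_proj _ (restrict (dist_vec C)).
Proof. by rewrite phi_pi; apply: vquot_map_proj; exact: restrict_Phi. Qed.

Lemma phi_ft (hn : (3 <= n)%N) (x : moduli R n.+1) :
  phi (ft hn x) = forget (phi x).
Proof.
rewrite -[x]reprK; move: (repr x) => C; rewrite ft_pi forget_phi phi_pi.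
apply/esym/pi_vquotP; rewrite /ft_curve; case: eq_comparable => hv.
  suff -> : restrict (dist_vec C) - dist_vec (straighten hn hv) =
            Phi [ffun i => absorbed hn hv i] by exact: mem_Phi.
  apply/ffunP=> p; rewrite !ffunE /= dist_straighten.
    by rewrite addrC addKr.
  by apply: contraTneq (valP p) => /= ->; rewrite ltnn.
suff -> : restrict (dist_vec C) = dist_vec (drop_end hv) by rewrite subrr mem0v.
by apply/ffunP=> p; rewrite !ffunE dist_drop_end.
Qed.
End Restriction.

(** * Preservation of the lattice *)

Section Lattice.
Variables (R : realType) (n : nat).

Lemma Lambda0 : Lambda (0 : Qn R n).
Proof. by exists (fun=> 0); rewrite big1. Qed.

Lemma LambdaD (x y : Qn R n) : Lambda x -> Lambda y -> Lambda (x + y).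
Proof.
move=> [c ->] [d ->]; exists (fun I => c I + d I); rewrite -big_split.
by apply: eq_bigr => I _; rewrite mulrzDr.
Qed.

Lemma LambdaMz (x : Qn R n) m : Lambda x -> Lambda (x *~ m).
Proof.
move=> [c ->]; exists (fun I => c I * m); rewrite mulrz_suml.
by apply: eq_bigr => I _; rewrite mulrzA.
Qed.

Lemma Lambda_vI (I : splitting n) : Lambda (vI R I).
Proof.
exists (fun J => (J == I)%:R); rewrite (bigD1 I) //= eqxx mulr1z big1 ?addr0 //.
by move=> J /negbTE->.
Qed.

Lemma dist_split_curve (I : splitting n) i j :
  dist (split_curve R I) i j = ((i \in val I) != (j \in val I))%:R.
Proof.
have [e|ne] := eqVneq (i \in val I) (j \in val I).
  by rewrite (@dist_path _ _ _ i j [::]) //= /split_mark e.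
rewrite (@dist_path _ _ (split_curve R I) i j [:: split_mark I j]) //=.
- by rewrite addr0.
- by rewrite andbT /split_adj /split_mark; move: ne; do 2 case: ifP.
- by rewrite inE andbT /split_mark; move: ne; do 2 case: ifP.
Qed.
End Lattice.

(** A set and its complement separate the same pairs, so a set whose cardinal is
too small or too large by one to give a splitting cuts off a single point. *)
Lemma cut_singleton (n : nat) (A : {set 'I_n}) : #|A| = 1%N \/ #|A| = n.-1 ->
  (0 < n)%N ->
  exists k, forall i j, ((i \in A) != (j \in A)) = ((i == k) != (j == k)).
Proof.
move=> [/eqP/cards1P[k ->]|cA] n0; first by exists k => i j; rewrite !inE.
have /cards1P[k Ak] : #|~: A| == 1%N.
  by rewrite -(eqn_add2l #|A|) cardsC card_ord cA addn1 prednK.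
exists k => i j; rewrite -!(in_set1 _ k) -Ak !inE.
by case: (i \in A); case: (j \in A).
Qed.

(** A generator goes to a generator or to 0.  The trace [A] on the old ends has at
most one element less than [I], and its complement at most one less than that of
[I]; hence when [A] is no splitting, one of the two is a singleton. *)
Lemma forget_vI (R : realType) n (I : splitting n.+1) : Lambda (forget (vI R I)).
Proof.
rewrite /vI forget_phi; set A := [set i | old_end i \in val I].
have cardA : #|val I| = (#|A| + (ord_max \in val I))%N.
  have := card_old_end (mem (val I)); rewrite cardsE /= => <-.
  by apply: eq_card => i; rewrite !inE.
have restrictE p : restrict (dist_vec (split_curve R I)) p =
    (((val p).1 \in A) != ((val p).2 \in A))%:R.
  by rewrite !ffunE dist_split_curve !inE.
have [cA|ncA] := boolP (1 < #|A| < n.-1)%N.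
  suff -> : restrict (dist_vec (split_curve R I)) =
      dist_vec (split_curve R (Sub A cA)) by rewrite -phi_pi; exact: Lambda_vI.
  by apply/ffunP => p; rewrite restrictE ffunE dist_split_curve.
have [I1 I2] := andP (valP I).
have [k cutk] : exists k, forall i j,
    ((i \in A) != (j \in A)) = ((i == k) != (j == k)).
  apply: cut_singleton; last exact: ltnW (ltn_trans I1 I2).
  by move: ncA I1 I2; rewrite cardA; case: (_ \in _); move: #|A| => a /=; lia.
(* For a pair of distinct ends, being separated by [k] means containing [k]. *)
set e := [ffun i => (i == k)%:R] : {ffun 'I_n -> R^o}.
have -> : restrict (dist_vec (split_curve R I)) = Phi e.
  apply/ffunP => p; rewrite restrictE cutk !ffunE.
  have [ek|_] := eqVneq (val p).1 k; have [e'k|_] := eqVneq (val p).2 k;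
    rewrite ?addr0 ?add0r //.
  by have := valP p; rewrite /= ek e'k ltnn.
have -> : vquot_proj (limg (linfun (@Phi R n))) (Phi e) = 0; last exact: Lambda0.
rewrite -[RHS](raddf0 (vquot_proj (limg (linfun (@Phi R n))))).
by apply/pi_vquotP; rewrite subr0; exact: mem_Phi.
Qed.

Theorem proposition3p12 (R : realType) (n : nat) (hn : (4 <= n.+1)%N) :
  fan_morphism (@phi R n.+1) (@Lambda R n.+1) (@phi R n) (@Lambda R n)
    (@ft R n hn).
Proof.
exists (@forget R n); split=> [x [c ->]|x]; last exact: phi_ft.
rewrite raddf_sum; apply: big_ind => [||I _]; [exact: Lambda0|exact: LambdaD|].
by rewrite raddfMz; apply/LambdaMz/forget_vI.
Qed.
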